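(* Let $0<T_{min}\le T_{max}<\infty$ and assume that there exist matrices $P_i\in\mathbb{S}^{n+m}_{\succ0}$, $i=1,\ldots,N$, a nonnegative matrix $\Pi=[\pi_{ij}]\in\mathbb{R}^{N\times N}$ (i.e. with nonnegative entries) verifying $\mathbf{1}_N^T\Pi=\mathbf{1}_N^T$ and a scalar $\varepsilon>0$ such that the condition $$\bar J_i^Te^{\bar A^T\theta}\left(\sum_{j=1}^N\pi_{ji}P_j\right)e^{\bar A\theta}\bar J_i-P_i+\varepsilon I\preceq0$$ holds for all $i=1,\ldots,N$ and all $\theta\in[T_{min},T_{max}]$. Then the sampled-data impulsive system $$\begin{array}{rcl}\dot{x}(t)&=&Ax(t)+Bu(t),\ t\in\mathbb{R}_{\ge0}\backslash\{t_k\}_{k=0}^\infty\\ u(t)&=&K_{\sigma(t_k^+)}^1x(t_k)+K_{\sigma(t_k^+)}^2u(t_k),\ t\in(t_k,t_{k+1}]\\ x(t_k^+)&=&J_{\sigma(t_k^+)}x(t_k),\ k\in\mathbb{Z}_{\ge0}\end{array}$$ controlled with the min-jumping rule $$\sigma(t_k^+)=\operatorname*{arg\,min}_{i\in\{1,\ldots,N\}}\left\{\chi(t_k)^TP_i\chi(t_k)\right\},\qquad \chi(t):=\begin{bmatrix}x(t)\\ u(t)\end{bmatrix},$$ is asymptotically stable for any sequence $\{t_k\}_{k=0}^\infty$ satisfying the range dwell-time condition $t_{k+1}-t_k\in[T_{min},T_{max}]$ for all $k\in\mathbb{Z}_{\ge0}$.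
   Context: $\mathbb{S}^{q}$ is the set of real symmetric $q\times q$ matrices, $\mathbb{S}^{q}_{\succ0}$ the positive definite ones; $X\preceq0$ (resp. $X\prec0$) means negative semidefinite (resp. definite). $\mathbf{1}_N$ is the $N$-vector of ones. Data: integers $n,m,N\ge1$, real matrices $A\in\mathbb{R}^{n\times n}$, $B\in\mathbb{R}^{n\times m}$, $J_i\in\mathbb{R}^{n\times n}$, $K_i^1\in\mathbb{R}^{m\times n}$, $K_i^2\in\mathbb{R}^{m\times m}$, $i=1,\ldots,N$. Trajectories are left-continuous: $x(t_k)=\lim_{s\uparrow t_k}x(s)$ and $x(t_k^+):=\lim_{s\downarrow t_k}x(s)$ (similarly for $u$, $\sigma$). The signal $\sigma(t)\in\{1,\ldots,N\}$ is piecewise constant and only changes value at the instants $t_k$ (it is constant on each $(t_k,t_{k+1}]$). In the rule, if the minimizer is not unique, any minimizer may be chosen. With $\chi=\mathrm{col}(x,u)$ the system is equivalently written as $\dot\chi(t)=\bar A\chi(t)$ for $t\notin\{t_k\}$ and $\chi(t_k^+)=\bar J_{\sigma(t_k^+)}\chi(t_k)$, where $$\bar A=\begin{bmatrix}A&B\\ 0&0\end{bmatrix},\qquad \bar J_i=\begin{bmatrix}J_i&0\\ K_i^1&K_i^2\end{bmatrix}.$$ Asymptotic stability is understood in the usual sense for the zero solution of this (augmented) system: Lyapunov stability and convergence of $\chi(t)$ to $0$ as $t\to\infty$. *)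

(* Defs.v *)
From HB Require Import structures.
From mathcomp Require Import all_boot all_order all_algebra.
From mathcomp Require Import all_classical all_reals all_analysis.
Set Implicit Arguments.
Unset Strict Implicit.
Unset Printing Implicit Defensive.
Import Order.TTheory GRing.Theory Num.Theory numFieldNormedType.Exports.
Local Open Scope classical_set_scope.
Local Open Scope ring_scope.

Definition qform (R : realType) (q : nat) (M : 'M[R]_q) (z : 'cV[R]_q) : R :=
  (z^T *m M *m z) ord0 ord0.

Definition posdef (R : realType) (q : nat) (M : 'M[R]_q) : Prop :=
  M^T = M /\ forall z : 'cV[R]_q, z != 0 -> 0 < qform M z.

Definition negsemidef (R : realType) (q : nat) (M : 'M[R]_q) : Prop :=
  M^T = M /\ forall z : 'cV[R]_q, qform M z <= 0.

(* The limit is taken in the normed (entrywise) topology of 'M[R]_q. *)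
Definition expmx (R : realType) (q : nat) (M : 'M[R]_q) : 'M[R]_q :=
  limn (series (fun k : nat => (k`!%:R^-1 : R) *: M ^+ k)).

Definition Abar (R : realType) (n m : nat) (A : 'M[R]_n) (B : 'M[R]_(n, m)) :
    'M[R]_(n + m) :=
  block_mx A B 0 0.

Definition Jbar (R : realType) (n m : nat) (J : 'M[R]_n) (K1 : 'M[R]_(m, n))
    (K2 : 'M[R]_m) : 'M[R]_(n + m) :=
  block_mx J 0 K1 K2.

Definition dwell_range (R : realType) (Tmin Tmax : R) (t : nat -> R) : Prop :=
  0 <= t 0%N /\ forall k : nat, Tmin <= t k.+1 - t k <= Tmax.

(* Derivative relative to the time domain [0, +oo[: two-sided at s > 0 and
   one-sided at s = 0. *)
Definition time_derivative (R : realType) (q : nat) (f : R -> 'cV[R]_q)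
    (s : R) (v : 'cV[R]_q) : Prop :=
  h^-1 *: (f (s + h) - f s)
    @[h --> within [set h : R | 0 <= s + h] (0 : R)^'] --> v.

(* [right_value sigma s i] is sigma(s^+) = i: the right limit of sigma at s,
   'I_N being discrete. *)
Definition right_value (R : realType) (N : nat) (sigma : R -> 'I_N) (s : R)
    (i : 'I_N) : Prop :=
  \forall r \near s^'+, sigma r = i.

Definition is_argmin (R : realType) (N : nat) (f : 'I_N -> R) (i : 'I_N) :
    Prop :=
  forall j : 'I_N, f i <= f j.

(* Functions of time are total on R, but only their values on [0, +oo[ are
   constrained.  The initial time is 0, the value at 0 being the pre-jump one
   when t 0 = 0; when 0 < t 0, no jump has occurred yet on [0, t 0], where
   the input and the mode are held constant. *)
Record min_jumping_solution (R : realType) (n m N : nat)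
    (A : 'M[R]_n) (B : 'M[R]_(n, m)) (J : 'I_N -> 'M[R]_n)
    (K1 : 'I_N -> 'M[R]_(m, n)) (K2 : 'I_N -> 'M[R]_m)
    (P : 'I_N -> 'M[R]_(n + m)) (t : nat -> R)
    (x : R -> 'cV[R]_n) (u : R -> 'cV[R]_m) (sigma : R -> 'I_N) : Prop :=
  MinJumpingSolution {
    sol_left_continuous : forall s : R, 0 < s ->
      x r @[r --> s^'-] --> x s;
    sol_flow : forall s : R, 0 <= s -> (forall k : nat, s != t k) ->
      time_derivative x s (A *m x s + B *m u s);
    sol_jump : forall (k : nat) (i : 'I_N), right_value sigma (t k) i ->
      x r @[r --> (t k)^'+] --> J i *m x (t k);
    sol_input : forall (k : nat) (i : 'I_N), right_value sigma (t k) i ->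
      forall s : R, t k < s <= t k.+1 ->
      u s = K1 i *m x (t k) + K2 i *m u (t k);
    sol_input_initial : forall s : R, 0 <= s <= t 0%N -> u s = u 0;
    sol_mode : forall (k : nat) (s : R), t k < s <= t k.+1 ->
      sigma s = sigma (t k.+1);
    sol_mode_initial : forall s : R, 0 <= s <= t 0%N -> sigma s = sigma 0;
    sol_rule : forall (k : nat) (i : 'I_N), right_value sigma (t k) i ->
      is_argmin (fun j => qform (P j) (col_mx (x (t k)) (u (t k)))) i
  }.

Definition min_jumping_trajectories (R : realType) (n m N : nat)
    (A : 'M[R]_n) (B : 'M[R]_(n, m)) (J : 'I_N -> 'M[R]_n)
    (K1 : 'I_N -> 'M[R]_(m, n)) (K2 : 'I_N -> 'M[R]_m)
    (P : 'I_N -> 'M[R]_(n + m)) (t : nat -> R) : set (R -> 'cV[R]_(n + m)) :=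
  [set chi | exists (x : R -> 'cV[R]_n) (u : R -> 'cV[R]_m)
      (sigma : R -> 'I_N),
    min_jumping_solution A B J K1 K2 P t x u sigma /\
    chi = (fun s => col_mx (x s) (u s))].

Definition asymptotically_stable (R : realType) (q : nat)
    (S : set (R -> 'cV[R]_q)) : Prop :=
  (forall e : R, 0 < e -> exists2 d : R, 0 < d &
     forall chi : R -> 'cV[R]_q, S chi -> `|chi 0| < d ->
     forall s : R, 0 <= s -> `|chi s| < e) /\
  (forall chi : R -> 'cV[R]_q, S chi -> chi s @[s --> +oo] --> (0 : 'cV[R]_q)).

(* Main.v *)
Require Import Defs.
From HB Require Import structures.
From mathcomp Require Import all_boot all_order all_algebra.
From mathcomp Require Import all_classical all_reals all_analysis.
From mathcomp Require Import ring lra.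
Set Implicit Arguments.
Unset Strict Implicit.
Unset Printing Implicit Defensive.
Import Order.TTheory GRing.Theory Num.Theory numFieldNormedType.Exports.
Local Open Scope classical_set_scope.
Local Open Scope ring_scope.

(* Along a solution with z k = chi (t k) and active mode i k, set
   V k = z k ^T P_(i k) z k, the minimum over j of z k ^T P_j z k.  On
   ]t k, t (k + 1)] the input is constant, so z (k + 1) is
   e^(Abar theta) Jbar_(i k) z k.  The minimum V (k + 1) is at most the average
   of the z (k + 1)^T P_j z (k + 1) with weights pi_(j, i k), which the matrix
   inequality bounds by V k - eps |z k|^2.  As V k is at most a constant
   times |z k|^2, V decays geometrically, and between jumps chi is bounded by
   a constant times |z k| because theta stays bounded.

   That solutions of z' = M z are given by the exponential series needs no
   derivative of the matrix exponential: for each coordinate i, Taylor's formula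
   at the left endpoint applies to c_0 = z_i, whose successive derivatives are
   c_k = (M^k z)_i and grow at most geometrically. *)

(** * Entrywise norm and the exponential series *)

Lemma mx_norm_entry (R : realType) (p q : nat) (M : 'M[R]_(p, q)) i j :
  `|M i j| <= `|M|.
Proof.
rewrite [leRHS]/Num.Def.normr /= mx_normrE.
by apply: (@le_bigmax _ _ _ _ (fun ij => `|M ij.1 ij.2|) (i, j)).
Qed.

Lemma mx_norm_le (R : realType) (p q : nat) (M : 'M[R]_(p, q)) (c : R) :
  0 <= c -> (forall i j, `|M i j| <= c) -> `|M| <= c.
Proof.
move=> c0 Mc; rewrite [leLHS]/Num.Def.normr /= mx_normrE.
by apply: bigmax_le => // -[i j] _; exact: Mc.
Qed.

(** The norm is the largest absolute value of an entry, so it is not submultiplicative: an entry of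
    the product sums [q] terms, whence the factor [q]. *)
Lemma mx_norm_mulmx (R : realType) (p q r : nat) (M : 'M[R]_(p, q))
    (M' : 'M[R]_(q, r)) : `|M *m M'| <= q%:R * (`|M| * `|M'|).
Proof.
apply: mx_norm_le => [|i j]; first by rewrite !mulr_ge0.
rewrite mxE (le_trans (ler_norm_sum _ _ _))//.
rewrite (@le_trans _ _ (\sum_(k < q) `|M| * `|M'|))//.
  by apply: ler_sum => k _; rewrite normrM ler_pM ?mx_norm_entry.
by rewrite sumr_const card_ord mulr_natl.
Qed.

Lemma mx_norm_expr (R : realType) (q : nat) (M : 'M[R]_q) (k : nat) :
  `|M ^+ k| <= (q%:R * `|M|) ^+ k.
Proof.
elim: k => [|k IH].
  rewrite !expr0; apply: mx_norm_le => // i j.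
  by rewrite mxE; case: eqP; rewrite ?normr1 ?normr0.
rewrite !exprS (le_trans (mx_norm_mulmx _ _))// -mulrA.
by do 2 rewrite ler_wpM2l//.
Qed.

Lemma cvg_mx_entry (R : realType) (p q : nat) (T : Type) (F : set_system T)
    (f : T -> 'M[R]_(p, q)) (M : 'M[R]_(p, q)) : Filter F ->
  (forall i j, f x i j @[x --> F] --> M i j) -> f x @[x --> F] --> M.
Proof.
move=> FF fM A [Q MQ QA].
apply: (@filterS _ F _ [set x | forall i j, Q i j (f x i j)]).
  by move=> x /= Qx; apply: QA.
by apply: filter_forall => i; apply: filter_forall => j; exact: fM (MQ i j).
Qed.

Lemma scale_expr_mx (R : realType) (q : nat) (M : 'M[R]_q) (a : R) (k : nat) :
  (a *: M) ^+ k = a ^+ k *: M ^+ k.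
Proof.
elim: k => [|k IH]; first by rewrite !expr0 scale1r.
rewrite !exprS IH.
by rewrite -[LHS]/((a *: M) *m (a ^+ k *: M ^+ k)) -scalemxAl -scalemxAr scalerA.
Qed.

Lemma cvg_norm_expmx_entry (R : realType) (q : nat) (M : 'M[R]_q) i j :
  cvgn [normed series (fun k => k`!%:R^-1 * (M ^+ k) i j)] /\
  limn [normed series (fun k => k`!%:R^-1 * (M ^+ k) i j)]
    <= expR (q%:R * `|M|).
Proof.
have le k : `|k`!%:R^-1 * (M ^+ k) i j| <= exp_coeff (q%:R * `|M|) k.
  rewrite exp_coeffE/= normrM ger0_norm ?invr_ge0// ler_wpM2l ?invr_ge0//.
  exact: le_trans (mx_norm_entry _ _ _) (mx_norm_expr _ _).
have cv : cvgn [normed series (fun k => k`!%:R^-1 * (M ^+ k) i j)].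
  apply: (series_le_cvg _ _ le (is_cvg_series_exp_coeff _)) => // k.
  exact: le_trans (normr_ge0 _) (le k).
split => //; apply: lim_series_le => //; exact: is_cvg_series_exp_coeff.
Qed.

(** [expmx] is a bare limit, meaningful only once the series converges. The entrywise sums [L] exist
    by absolute convergence, and the partial sums converge to [L], so [expmx M] is [L]. *)
Lemma expmx_entry (R : realType) (q : nat) (M : 'M[R]_q) i j :
  series (fun k => k`!%:R^-1 * (M ^+ k) i j) @ \oo --> expmx M i j.
Proof.
pose L := \matrix_(i, j) limn (series (fun k => k`!%:R^-1 * (M ^+ k) i j)).
suff ML : expmx M = L.
  by rewrite ML mxE; apply: normed_cvg; case: (cvg_norm_expmx_entry M i j).
apply: cvg_lim => //; apply: cvg_mx_entry => k l; rewrite mxE.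
rewrite (_ : (fun n => _) = series (fun n => n`!%:R^-1 * (M ^+ n) k l)).
  by apply: normed_cvg; case: (cvg_norm_expmx_entry M k l).
by apply/funext => n; rewrite /series/= summxE; apply: eq_bigr => h _; rewrite mxE.
Qed.

Lemma mx_norm_expmx (R : realType) (q : nat) (M : 'M[R]_q) :
  `|expmx M| <= expR (q%:R * `|M|).
Proof.
apply: mx_norm_le => [|i j]; first exact: expR_ge0.
have [cv le] := cvg_norm_expmx_entry M i j.
rewrite -(cvg_lim _ (expmx_entry (M := M) (i := i) (j := j)))//.
exact: le_trans (lim_series_norm cv) le.
Qed.

Lemma trmx_expr (R : realType) (q : nat) (M : 'M[R]_q) (k : nat) :
  (M ^+ k)^T = M^T ^+ k.
Proof.
elim: k => [|k IH]; first by rewrite !expr0 trmx1.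
by rewrite exprSr exprS -IH; exact: trmx_mul.
Qed.

(** Lets the exponential of a transpose on the left of the matrix inequality be read as the
    transpose of the one on the right, so that [qform_congr] applies. *)
Lemma trmx_expmx (R : realType) (q : nat) (M : 'M[R]_q) :
  (expmx M)^T = expmx M^T.
Proof.
apply/matrixP => i j; rewrite mxE.
apply: cvg_unique (expmx_entry (M := M) (i := j) (j := i)) _ => //.
rewrite (_ : (fun k => _) = (fun k => k`!%:R^-1 * (M^T ^+ k) i j)).
  exact: expmx_entry.
by apply/funext => k; rewrite -trmx_expr mxE.
Qed.

(* The function [g n] of the proof telescopes under differentiation, so the
   mean value theorem bounds [g n b - g n a] by a term of an exponential
   series. *)
Lemma taylor_cvg (R : realType) (c : nat -> R -> R) (a b C L : R) : a <= b ->
  (forall k, {within `[a, b], continuous (c k)}) ->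
  (forall k x, x \in `]a, b[ -> is_derive x 1 (c k) (c k.+1 x)) ->
  (forall k x, x \in `[a, b] -> `|c k x| <= C * L ^+ k) ->
  series (fun k => k`!%:R^-1 * ((b - a) ^+ k * c k a)) @ \oo --> c 0 b.
Proof.
move=> ab cc dc bc.
pose g n x := \sum_(k < n.+1) k`!%:R^-1 * ((b - x) ^+ k * c k x).
have gE n x : g n.+1 x = g n x + n.+1`!%:R^-1 * ((b - x) ^+ n.+1 * c n.+1 x).
  by rewrite /g big_ord_recr.
have gb n : g n b = c 0 b.
  rewrite /g big_ord_recl big1 ?addr0 => [|i _]; first by rewrite fact0 invr1 !mul1r.
  by rewrite subrr expr0n /= mul0r mulr0.
have dg n x : x \in `]a, b[ ->
    is_derive x 1 (g n) (n`!%:R^-1 * ((b - x) ^+ n * c n.+1 x)).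
  move=> xab; elim: n => [|n IH].
    have -> : g 0 = c 0.
      by apply/funext => y; rewrite /g big_ord1 fact0 invr1 !mul1r.
    by rewrite fact0 invr1 !mul1r; exact: dc.
  have -> : g n.+1 = g n +
      (fun x => n.+1`!%:R^-1 *: ((b - x) ^+ n.+1 * c n.+1 x)).
    by apply/funext => y; rewrite gE.
  have d1 : is_derive x 1 (fun y : R => b - y) (-1).
    by rewrite -[-1]sub0r; apply: (is_deriveB (is_derive_cst b x 1) (is_derive_id x 1)).
  have d2 : is_derive x 1 (fun y : R => (b - y) ^+ n.+1)
      (- (n.+1%:R * (b - x) ^+ n)).
    have -> : - (n.+1%:R * (b - x) ^+ n) = (n.+1%:R * (b - x) ^+ n) *: (-1 : R).
      by rewrite /GRing.scale/= mulrN1.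
    by have := is_deriveX n.+1 d1; rewrite exprfctE.
  have d3 := is_deriveM d2 (dc n.+1 x xab).
  have d4 := is_deriveZ n.+1`!%:R^-1 d3.
  apply: (is_derive_eq (is_deriveD IH d4)).
  rewrite /GRing.scale/= factS natrM exprS.
  have n0 : (n.+1)%:R != 0 :> R by rewrite pnatr_eq0.
  have f0 : (n`!)%:R != 0 :> R by rewrite pnatr_eq0 -lt0n fact_gt0.
  by field; rewrite f0 nat1r n0.
have cp n : {within `[a, b], continuous (fun y => (b - y) ^+ n)}.
  apply: continuous_subspaceT => y.
  apply: (@continuous_comp _ _ _ (fun y : R => b - y) (fun z => z ^+ n)).
    by apply: cvgB; [exact: cvg_cst | exact: cvg_id].
  exact: exprn_continuous.
have cg n : {within `[a, b], continuous (g n)}.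
  elim: n => [|n IH].
    have -> : g 0 = c 0.
      by apply/funext => y; rewrite /g big_ord1 fact0 invr1 !mul1r.
    exact: cc.
  move=> x; have -> : g n.+1 = g n +
      (fun x => n.+1`!%:R^-1 * ((b - x) ^+ n.+1 * c n.+1 x)).
    by apply/funext => y; rewrite gE.
  apply: cvgD; first exact: IH.
  apply: cvgMr; apply: cvgM; last exact: cc.
  exact: cp.
have C0 : 0 <= C.
  have := bc 0 a; rewrite expr0 mulr1 => /(_ _)/(le_trans (normr_ge0 _)).
  by apply; rewrite in_itv/= lexx.
(* The mean value theorem contributes the factor [b - a], and [c n.+1] one power of [L] more than
   [exp_coeff] absorbs. The sign of [L] is free, hence the absolute values. *)
have gn n : `|c 0 b - g n a| <= (C * `|L| * (b - a)) * exp_coeff ((b - a) * `|L|) n.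
  rewrite -(gb n); have [x xab ->] := MVT_segment ab (dg n) (cg n).
  have /andP[ax xb] : a <= x <= b by [].
  rewrite exp_coeffE/= !normrM (ger0_norm (_ : 0 <= b - a)) ?subr_ge0//.
  rewrite ger0_norm ?invr_ge0// normrX (ger0_norm (_ : 0 <= b - x)) ?subr_ge0//.
  have le1 : `|c n.+1 x| <= C * `|L| ^+ n.+1.
    rewrite (le_trans (bc _ _ xab))// ler_wpM2l//.
    by rewrite -normrX ler_norm.
  have le2 : (b - x) ^+ n <= (b - a) ^+ n.
    by rewrite lerXn2r ?nnegrE ?subr_ge0// lerD2l lerN2.
  apply: (@le_trans _ _ (n`!%:R^-1 * ((b - a) ^+ n * (C * `|L| ^+ n.+1)) * (b - a))).
    rewrite ler_wpM2r ?subr_ge0// ler_wpM2l ?invr_ge0//.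
    by rewrite ler_pM// exprn_ge0// subr_ge0.
  by rewrite exprMn exprS le_eqVlt; apply/orP; left; apply/eqP; ring.
(* [g n] has [n.+1] terms, so it is the partial sum of index [n.+1]. *)
rewrite -cvg_shiftS /=.
have -> : (fun n => series (fun k => k`!%:R^-1 * ((b - a) ^+ k * c k a)) n.+1)
    = (fun n => g n a).
  by apply/funext => n; rewrite /series/= big_mkord.
apply/cvgrPdist_le => e e0.
have : (C * `|L| * (b - a)) * exp_coeff ((b - a) * `|L|) n @[n --> \oo] --> 0.
  by rewrite -[X in _ --> X](mulr0 (C * `|L| * (b - a))); apply: cvgMr; exact: cvg_exp_coeff.
move=> /cvgr0_norm_le/(_ e e0); apply: filterS => n /= le.
exact: le_trans (gn n) (le_trans (ler_norm _) le).
Qed.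

(** * Linear flows *)

Lemma expmx_flow (R : realType) (q : nat) (M : 'M[R]_q) (a b : R)
    (z : R -> 'cV[R]_q) : a <= b ->
  (forall i, {within `[a, b], continuous (fun s => z s i ord0)}) ->
  (forall i s, s \in `]a, b[ ->
     is_derive s 1 (fun r => z r i ord0) ((M *m z s) i ord0)) ->
  z b = expmx ((b - a) *: M) *m z a.
Proof.
move=> ab cz dz; apply/matrixP => i j; rewrite (ord1 j).
have bz k : exists C, forall s, s \in `[a, b] -> `|z s k ord0| <= C.
  have cn : {within `[a, b], continuous (fun s => `|z s k ord0|)}.
    by move=> s; apply: cvg_norm; exact: cz.
  have [s _ sP] := EVT_max ab cn.
  by exists `|z s k ord0|.
have [C CP] := choice bz.
have C0 k : 0 <= C k.
  by apply: le_trans (normr_ge0 _) (CP k a _); rewrite in_itv/= lexx.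
have {}bz s : s \in `[a, b] -> `|z s| <= \sum_k C k.
  move=> sab; apply: mx_norm_le => [|k l]; first by rewrite sumr_ge0.
  by rewrite (ord1 l) (le_trans (CP k s sab))// (bigD1 k)//= lerDl sumr_ge0.
pose c k s := (M ^+ k *m z s) i ord0.
have cE k s : c k s = \sum_j (M ^+ k) i j * z s j ord0 by rewrite /c mxE.
have cS k : c k = \sum_j (fun s => (M ^+ k) i j *: z s j ord0).
  by rewrite fct_sumE; apply/funext => s; rewrite cE.
have cc k : {within `[a, b], continuous (c k)}.
  move=> s; rewrite (_ : c k = fun s => \sum_j (M ^+ k) i j * z s j ord0).
    apply: cvg_big; first exact: add_continuous.
    by move=> j0 _; apply: cvgMr; exact: cz.
  by apply/funext => r; rewrite cE.
have dc k s : s \in `]a, b[ -> is_derive s 1 (c k) (c k.+1 s).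
  move=> sab; rewrite cS.
  apply: (is_derive_eq (is_derive_sum
    (fun j0 => is_deriveZ ((M ^+ k) i j0) (dz j0 s sab)))).
  by rewrite /c exprSr -[M ^+ k * M]/(M ^+ k *m M) -mulmxA [in RHS]mxE.
have bc k s : s \in `[a, b] ->
    `|c k s| <= (q%:R * \sum_k C k) * (q%:R * `|M|) ^+ k.
  move=> sab; rewrite (le_trans (mx_norm_entry _ _ _))//.
  rewrite (le_trans (mx_norm_mulmx _ _))// -mulrA ler_wpM2l// mulrC.
  by rewrite ler_pM ?bz ?mx_norm_expr.
have := taylor_cvg ab cc dc bc.
(* The Taylor series converges to the coordinate of [z b]; it remains to show that it also converges
   to that of the exponential applied to [z a]. *)
rewrite /c expr0 mul1mx => /cvg_unique; apply => //.
have -> : series (fun k => k`!%:R^-1 * ((b - a) ^+ k * (M ^+ k *m z a) i ord0))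
    = (fun n => \sum_j series (fun k => k`!%:R^-1 * (((b - a) *: M) ^+ k) i j) n
         * z a j ord0).
  apply/funext => n; rewrite /series/=.
  under [RHS]eq_bigr do rewrite mulr_suml.
  rewrite exchange_big/=; apply: eq_bigr => k _.
  rewrite mxE mulr_sumr mulr_sumr; apply: eq_bigr => l _.
  by rewrite scale_expr_mx mxE; ring.
rewrite mxE; apply: (cvg_big (@add_continuous R^o)) => l _.
by apply: cvgMl; exact: expmx_entry.
Qed.

(** After a jump the flow starts from the right limit [w], while [z a] is the pre-jump value.
    Changing [z] at the single point [a] into [w] gives [y], continuous on the closed interval. *)
Lemma expmx_flow_right_limit (R : realType) (q : nat) (M : 'M[R]_q) (a b : R)
    (z : R -> 'cV[R]_q) (w : 'cV[R]_q) : a < b ->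
  (forall i, z s i ord0 @[s --> a^'+] --> w i ord0) ->
  (forall i, z s i ord0 @[s --> b^'-] --> z b i ord0) ->
  (forall i s, a < s < b ->
     is_derive s 1 (fun r => z r i ord0) ((M *m z s) i ord0)) ->
  z b = expmx ((b - a) *: M) *m w.
Proof.
move=> ab za zb dz.
pose y s := if s == a then w else z s.
have yE s : a < s -> y s = z s by rewrite /y; case: eqP => // ->; rewrite ltxx.
have ya : y a = w by rewrite /y eqxx.
rewrite -(yE b ab) -ya.
have nbhsE s : a < s -> \forall r \near s, z r = y r.
  move=> as_; near=> r; rewrite yE//; near: r; exact: lt_nbhsr.
have dy i s : s \in `]a, b[ ->
    is_derive s 1 (fun r => y r i ord0) ((M *m y s) i ord0).
  rewrite in_itv/= => sab; have /andP[as_ sb] := sab.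
  rewrite yE//; apply: (near_eq_is_derive _ (dz i s sab)).
  by apply: filterS (nbhsE s as_) => r ->.
apply: (expmx_flow (ltW ab) _ dy) => i.
apply/continuous_within_itvP => //; split.
- move=> s sab; apply: differentiable_continuous.
  by apply/derivable1_diffP; have [] := dy i s sab.
- rewrite ya; apply: cvg_trans (za i); apply: near_eq_cvg.
  by near=> r; rewrite yE.
- rewrite yE//; apply: cvg_trans (zb i); apply: near_eq_cvg.
  near=> r; rewrite yE//; near: r; exact: nbhs_left_gt.
Unshelve. all: by end_near. Qed.

Lemma time_derivative_entry (R : realType) (q : nat) (f : R -> 'cV[R]_q)
    (s : R) (v : 'cV[R]_q) (i : 'I_q) : time_derivative f s v ->
  h^-1 * (f (s + h) i ord0 - f s i ord0)
    @[h --> within [set h : R | 0 <= s + h] (0 : R)^'] --> v i ord0.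
Proof.
move=> fv; have := cvg_comp _ _ fv (@coord_continuous R q 1 i ord0 v).
apply: cvg_trans; apply: near_eq_cvg; apply: nearW => h /=.
by rewrite !mxE.
Qed.

(** At a positive time, small increments never leave the time domain, so the relative derivative is
    the ordinary one. *)
Lemma time_derivative_is_derive (R : realType) (q : nat) (f : R -> 'cV[R]_q)
    (s : R) (v : 'cV[R]_q) (i : 'I_q) : 0 < s -> time_derivative f s v ->
  is_derive s 1 (fun r => f r i ord0) (v i ord0).
Proof.
move=> s0 /(time_derivative_entry (i := i)) fv.
have cv : h^-1 *: (((fun r => f r i ord0) \o shift s) (h *: 1) - f s i ord0)
    @[h --> (0 : R)^'] --> v i ord0.
  move=> E /fv /= vE.
  have {}vE : \forall h \near (0 : R)^',
    0 <= s + h -> E (h^-1 * (f (s + h) i ord0 - f s i ord0)) by exact: vE.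
  have Ds : \forall h \near (0 : R)^', 0 <= s + h.
    near=> h; have : `|h| < s.
      by near: h; apply: dnbhs0_lt.
    by rewrite ltr_norml => /andP[hs _]; lra.
  suff : \forall h \near (0 : R)^', E (h^-1 *: (((fun r => f r i ord0) \o
    shift s) (h *: 1) - f s i ord0)) by [].
  near=> h; rewrite /GRing.scale/= mulr1 (addrC h).
  have h0 : 0 <= s + h by near: h.
  by move: h0; near: h.
split; first exact: cvgP cv.
exact: cvg_lim cv.
Unshelve. all: by end_near. Qed.

(** Differentiability implies continuity: [f h] is [f 0] plus [h] times a convergent quotient. This
    supplies the right limit at time 0, where no jump condition gives it. *)
Lemma time_derivative_at_right0 (R : realType) (q : nat) (f : R -> 'cV[R]_q)
    (v : 'cV[R]_q) (i : 'I_q) : time_derivative f 0 v ->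
  f r i ord0 @[r --> 0^'+] --> f 0 i ord0.
Proof.
move=> /(time_derivative_entry (i := i)) fv.
have cv : h^-1 * (f (0 + h) i ord0 - f 0 i ord0)
    @[h --> (0 : R)^'+] --> v i ord0.
  move=> E /fv /= vE.
  have {}vE : \forall h \near (0 : R)^',
    0 <= 0 + h -> E (h^-1 * (f (0 + h) i ord0 - f 0 i ord0)) by exact: vE.
  have {}vE : \forall h \near (0 : R)^'+,
    0 <= 0 + h -> E (h^-1 * (f (0 + h) i ord0 - f 0 i ord0)).
    suff : (0 : R)^'+ `=>` (0 : R)^' by apply.
    by apply: within_subset => // h /= h0; rewrite gt_eqF.
  suff : \forall h \near (0 : R)^'+,
    E (h^-1 * (f (0 + h) i ord0 - f 0 i ord0)) by [].
  near=> h; have h0 : 0 <= 0 + h by rewrite add0r.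
  by move: h0; near: h.
have : f 0 i ord0 + h * (h^-1 * (f (0 + h) i ord0 - f 0 i ord0))
    @[h --> (0 : R)^'+] --> f 0 i ord0 + 0 * v i ord0.
  apply: cvgD; first exact: cvg_cst.
  by apply: cvgM cv; apply: cvg_within_filter; exact: cvg_id.
rewrite mul0r addr0; apply: cvg_trans; apply: near_eq_cvg.
by near=> h; rewrite mulrA mulfV ?gt_eqF// mul1r add0r addrC subrK.
Unshelve. all: by end_near. Qed.

(** * Quadratic forms, dwell times and stability *)

Lemma qformD (R : realType) (q : nat) (M M' : 'M[R]_q) (z : 'cV[R]_q) :
  qform (M + M') z = qform M z + qform M' z.
Proof. by rewrite /qform mulmxDr mulmxDl mxE. Qed.

Lemma qformN (R : realType) (q : nat) (M : 'M[R]_q) (z : 'cV[R]_q) :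
  qform (- M) z = - qform M z.
Proof. by rewrite /qform mulmxN mulNmx mxE. Qed.

Lemma qformZ (R : realType) (q : nat) (a : R) (M : 'M[R]_q) (z : 'cV[R]_q) :
  qform (a *: M) z = a * qform M z.
Proof. by rewrite /qform -scalemxAr -scalemxAl mxE. Qed.

Lemma qform_sum (R : realType) (q : nat) (I : finType) (M : I -> 'M[R]_q)
    (z : 'cV[R]_q) : qform (\sum_i M i) z = \sum_i qform (M i) z.
Proof. by rewrite /qform mulmx_sumr mulmx_suml summxE. Qed.

Lemma qform_congr (R : realType) (q : nat) (X M : 'M[R]_q) (z : 'cV[R]_q) :
  qform (X^T *m M *m X) z = qform M (X *m z).
Proof. by rewrite /qform trmx_mul !mulmxA. Qed.

Lemma mx_norm_trmx (R : realType) (p q : nat) (M : 'M[R]_(p, q)) :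
  `|M^T| <= `|M|.
Proof. by apply: mx_norm_le => // i j; rewrite mxE mx_norm_entry. Qed.

Lemma qform_le (R : realType) (q : nat) (M : 'M[R]_q) (z : 'cV[R]_q) :
  qform M z <= q%:R * (q%:R * `|M|) * `|z| ^+ 2.
Proof.
apply: le_trans (ler_norm _) (le_trans (mx_norm_entry _ _ _) _).
rewrite (le_trans (mx_norm_mulmx _ _))// -mulrA ler_wpM2l// expr2 mulrA.
rewrite ler_wpM2r// (le_trans (mx_norm_mulmx _ _))// -mulrA ler_wpM2l//.
by rewrite mulrC ler_wpM2l// mx_norm_trmx.
Qed.

(** The maximum norm is at most the Euclidean norm. *)
Lemma qform_scalar_ge (R : realType) (q : nat) (a : R) (z : 'cV[R]_q) :
  0 <= a -> a * `|z| ^+ 2 <= qform a%:M z.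
Proof.
move=> a0; rewrite -scalemx1 qformZ ler_wpM2l// /qform mulmx1.
have z2 i : z i ord0 ^+ 2 <= (z^T *m z) ord0 ord0.
  rewrite mxE (bigD1 i)//= !mxE -expr2 lerDl sumr_ge0// => j _.
  by rewrite mxE -expr2 sqr_ge0.
have zz0 : 0 <= (z^T *m z) ord0 ord0.
  by rewrite mxE sumr_ge0// => j _; rewrite mxE -expr2 sqr_ge0.
suff : `|z| <= Num.sqrt ((z^T *m z) ord0 ord0).
  by move=> le; rewrite -(sqr_sqrtr zz0) lerXn2r ?nnegrE ?sqrtr_ge0.
apply: mx_norm_le => [|i j]; first exact: sqrtr_ge0.
by rewrite (ord1 j) -sqrtr_sqr ler_wsqrtr.
Qed.

(** A minimum is at most any convex combination, and the matrix inequality evaluated at [z] bounds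
    the one with weights [w]. In use, [Q] is the matrix of the preceding mode and [w] a column of
    [Pi]. *)
Lemma argmin_weighted_decrease (R : realType) (q N : nat)
    (P : 'I_N -> 'M[R]_q) (w : 'I_N -> R) (X Q : 'M[R]_q) (eps : R)
    (i : 'I_N) (z : 'cV[R]_q) : 0 <= eps ->
  (forall j, 0 <= w j) -> \sum_j w j = 1 ->
  negsemidef (X^T *m (\sum_j w j *: P j) *m X - Q + eps%:M) ->
  is_argmin (fun j => qform (P j) (X *m z)) i ->
  qform (P i) (X *m z) <= qform Q z - eps * `|z| ^+ 2.
Proof.
move=> eps0 w0 w1 [_ /(_ z)] + iP.
rewrite 2!qformD qformN qform_congr qform_sum => le.
have := qform_scalar_ge z eps0.
have : qform (P i) (X *m z) <= \sum_j qform (w j *: P j) (X *m z).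
  rewrite -[leLHS]mul1r -w1 mulr_suml; apply: ler_sum => j _.
  by rewrite qformZ ler_wpM2l.
lra.
Qed.

Lemma dwell_range_le (R : realType) (Tmin Tmax : R) (t : nat -> R) (j k : nat) :
  0 <= Tmin -> dwell_range Tmin Tmax t -> (j <= k)%N ->
  t j + (k - j)%:R * Tmin <= t k.
Proof.
move=> T0 [_ tP]; elim: k => [|k IH].
  by rewrite leqn0 => /eqP->; rewrite subnn mul0r addr0.
rewrite leq_eqVlt => /orP[/eqP->|]; first by rewrite subnn mul0r addr0.
rewrite ltnS => jk; have {}IH := IH jk; have /andP[h _] := tP k.
by rewrite subSn// -natr1 mulrDl mul1r; lra.
Qed.

(** Jump times grow at least linearly, so some [t (k0 + d)] passes [s]; descending on [d] finds the
    interval. The bound [k0 <= k] serves convergence, where late times must lie after many jumps. *)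
Lemma dwell_range_locate (R : realType) (Tmin Tmax : R) (t : nat -> R)
    (k0 : nat) (s : R) : 0 < Tmin -> dwell_range Tmin Tmax t -> t k0 < s ->
  exists2 k, (k0 <= k)%N & t k < s <= t k.+1.
Proof.
move=> T0 tP ts.
have [d sd] : exists d : nat, s <= t (k0 + d)%N.
  exists (Num.truncn ((s - t k0) / Tmin)).+1.
  have := dwell_range_le (ltW T0) tP (leq_addr (Num.truncn ((s - t k0) / Tmin)).+1 k0).
  apply: le_trans; rewrite addKn -lerBlDl -ler_pdivrMr// ltW//.
  exact: truncnS_gt.
elim: d sd => [|d IH]; first by rewrite addn0 leNgt ts.
have [/IH//|h] := leP s (t (k0 + d)%N); rewrite addnS => h'.
by exists (k0 + d)%N; rewrite ?leq_addr// h h'.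
Qed.

(** The envelope is for squared norms, the form in which a quadratic Lyapunov function decays; [K]
    and [rho] are common to all solutions. *)
Lemma asymptotically_stable_envelope (R : realType) (q : nat)
    (S : set (R -> 'cV[R]_q)) (t : nat -> R) (Tmin Tmax K rho : R) :
  0 < Tmin -> dwell_range Tmin Tmax t -> 1 <= K -> 0 <= rho < 1 ->
  (forall chi s, S chi -> 0 <= s <= t 0%N ->
     `|chi s| ^+ 2 <= K * `|chi 0| ^+ 2) ->
  (forall chi k s, S chi -> t k < s <= t k.+1 ->
     `|chi s| ^+ 2 <= K * rho ^+ k * `|chi 0| ^+ 2) ->
  asymptotically_stable S.
Proof.
move=> T0 tP K1 /andP[rho0 rho1] S0 Sk; have K0 : 0 < K by lra.
split.
(* As [1 <= K], the factor [K] is at most [K ^+ 2], which avoids a square root in the choice of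
   [d]. *)
- move=> e e0; exists (e / K); first by rewrite divr_gt0.
  move=> chi Schi; rewrite ltr_pdivlMr// => chi0 s s0.
  have le : `|chi s| ^+ 2 <= K * `|chi 0| ^+ 2.
    have [st|ts] := leP s (t 0%N); first by apply: S0 => //; rewrite s0.
    have [k _ ks] := dwell_range_locate T0 tP ts.
    rewrite (le_trans (Sk _ _ _ Schi ks))// ler_wpM2r ?sqr_ge0//.
    by rewrite ler_piMr ?(ltW K0)// exprn_ile1// ltW.
  rewrite -(@ltr_pXn2r _ 2)// ?nnegrE ?(ltW e0)//; apply: le_lt_trans le _.
  apply: (@le_lt_trans _ _ ((`|chi 0| * K) ^+ 2)).
    by rewrite exprMn mulrC ler_wpM2l ?sqr_ge0// expr2 ler_peMl// ltW.
  by rewrite ltr_pXn2r ?nnegrE ?(ltW e0)// mulr_ge0// ltW.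
- move=> chi Schi; apply/cvgr0Pnorm_lt => e e0.
  have : K * rho ^+ k * `|chi 0| ^+ 2 @[k --> \oo] --> 0.
    rewrite -[X in _ --> X](mul0r (`|chi 0| ^+ 2)) -(mulr0 K).
    apply: cvgMl; apply: cvgMr; apply: cvg_expr.
    by rewrite ger0_norm.
  have e20 : 0 < e ^+ 2 by rewrite exprn_gt0.
  move=> /cvgr0_norm_lt/(_ _ e20)[k0 _ k0P].
  near=> s; have : t k0 < s by near: s; apply: nbhs_pinfty_gt; exact: num_real.
  move=> /(dwell_range_locate T0 tP)[k k0k ks].
  rewrite -(@ltr_pXn2r _ 2)// ?nnegrE ?(ltW e0)//.
  apply: le_lt_trans (Sk _ _ _ Schi ks) (le_lt_trans (ler_norm _) _).
  exact: k0P.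
Unshelve. all: by end_near. Qed.

Lemma posdef_ge0 (R : realType) (q : nat) (M : 'M[R]_q) (z : 'cV[R]_q) :
  posdef M -> 0 <= qform M z.
Proof.
move=> [_ M0]; have [->|/M0/ltW//] := eqVneq z 0.
by rewrite /qform mulmx0 mxE.
Qed.

(* Since [V (k + 1) >= 0], the decrease [V (k + 1) <= V k - eps |z k|^2] of
   [V k = qform (P (i k)) (z k)] also gives the coercivity [eps |z k|^2 <= V k]:
   no lower bound on the spectra of the [P j] is needed. *)
Lemma min_jumping_decay (R : realType) (q N : nat) (P : 'I_N -> 'M[R]_q)
    (eps : R) : 0 < eps -> (forall j, posdef (P j)) ->
  exists D rho : R, [/\ 0 <= D, 0 <= rho < 1 &
    forall (Pi : 'M[R]_N) (X : nat -> 'M[R]_q) (z : nat -> 'cV[R]_q)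
      (i : nat -> 'I_N),
    (forall j l, 0 <= Pi j l) -> (forall l, \sum_j Pi j l = 1) ->
    (forall k, negsemidef ((X k)^T *m (\sum_j Pi j (i k) *: P j) *m X k
                            - P (i k) + eps%:M)) ->
    (forall k, z k.+1 = X k *m z k) ->
    (forall k, is_argmin (fun j => qform (P j) (z k)) (i k)) ->
    forall k, `|z k| ^+ 2 <= D * rho ^+ k * `|z 0%N| ^+ 2].
Proof.
move=> eps0 Ppos.
(* A common upper bound for all the forms [P j]; the summand [eps] makes [c] positive and [eps / c]
   at most 1. *)
pose c := eps + \sum_j q%:R * (q%:R * `|P j|).
have b0 j : 0 <= q%:R * (q%:R * `|P j|) by rewrite !mulr_ge0.
have c0 : 0 < c by rewrite ltr_wpDr// sumr_ge0.
have Pc j y : qform (P j) y <= c * `|y| ^+ 2.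
  rewrite (le_trans (qform_le _ _))// ler_wpM2r ?sqr_ge0//.
  rewrite /c (bigD1 j)//= addrCA lerDl addr_ge0 ?(ltW eps0)//.
  by rewrite sumr_ge0.
(* From [eps * |z k|^2 <= V k <= c * |z k|^2]: the ratio of the two bounds is the overshoot, and
   each step loses at least the fraction [eps / c] of [V]. *)
exists (c / eps), (1 - eps / c); split.
- by rewrite divr_ge0 ?ltW.
- rewrite subr_ge0 ler_pdivrMr// mul1r lerDl sumr_ge0//=.
  by rewrite ltrBlDr ltrDl divr_gt0.
move=> Pi X z i Pi0 Pi1 LMI zS zmin.
pose V k := qform (P (i k)) (z k).
have V0 k : 0 <= V k by exact: posdef_ge0.
have VS k : V k.+1 <= V k - eps * `|z k| ^+ 2.
  rewrite /V zS; apply: (argmin_weighted_decrease (ltW eps0)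
    (fun j => Pi0 j (i k)) (Pi1 (i k)) (LMI k)).
  by rewrite -zS; exact: zmin.
have Vz k : eps * `|z k| ^+ 2 <= V k by have := V0 k.+1; have := VS k; lra.
have rho0 : 0 <= 1 - eps / c.
  by rewrite subr_ge0 ler_pdivrMr// mul1r lerDl sumr_ge0.
have VD k : V k <= (1 - eps / c) ^+ k * V 0%N.
  elim: k => [|k IH]; first by rewrite expr0 mul1r.
  apply: (@le_trans _ _ ((1 - eps / c) * V k)); last first.
    by rewrite exprS -mulrA ler_wpM2l.
  rewrite (le_trans (VS k))// mulrBl mul1r lerD2l lerN2.
  by rewrite -mulrA ler_wpM2l ?(ltW eps0)// mulrC ler_pdivrMr// mulrC Pc.
move=> k; rewrite -(ler_pM2l eps0) (le_trans (Vz k))// (le_trans (VD k))//.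
have -> : eps * (c / eps * (1 - eps / c) ^+ k * `|z 0%N| ^+ 2)
    = (1 - eps / c) ^+ k * (c * `|z 0%N| ^+ 2).
  by field; rewrite ?gt_eqF.
by rewrite ler_wpM2l ?exprn_ge0//; exact: Pc.
Qed.

(** * Solutions of the impulsive system *)

Lemma mulmx_Abar_col (R : realType) (n m : nat) (A : 'M[R]_n) (B : 'M[R]_(n, m))
    (x : 'cV[R]_n) (u : 'cV[R]_m) :
  Abar A B *m col_mx x u = col_mx (A *m x + B *m u) 0.
Proof. by rewrite mul_block_col !mul0mx addr0. Qed.

(** A constant input has derivative zero, which matches the zero lower blocks of [Abar]; the
    augmented state thus follows a linear flow. *)
Lemma constant_input_flow (R : realType) (n m : nat) (A : 'M[R]_n)
    (B : 'M[R]_(n, m)) (x : R -> 'cV[R]_n) (u : R -> 'cV[R]_m) (a b : R)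
    (w : 'cV[R]_n) (v : 'cV[R]_m) : 0 <= a -> a < b ->
  (forall i, x s i ord0 @[s --> a^'+] --> w i ord0) ->
  x s @[s --> b^'-] --> x b ->
  (forall s, a < s < b -> time_derivative x s (A *m x s + B *m u s)) ->
  (forall s, a < s <= b -> u s = v) ->
  col_mx (x b) (u b) = expmx ((b - a) *: Abar A B) *m col_mx w v.
Proof.
move=> a0 ab xa xb dx uv.
apply: (@expmx_flow_right_limit _ _ _ _ _ (fun s => col_mx (x s) (u s))) => //.
- move=> i; case: (split_ordP i) => j ->.
    rewrite col_mxEu; apply: cvg_trans (xa j); apply: near_eq_cvg.
    by apply: nearW => s; rewrite col_mxEu.
  rewrite col_mxEd.
  apply: (@cvg_trans _ ((fun=> v j ord0) @ a^'+)); last exact: cvg_cst.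
  apply: near_eq_cvg; near=> s; rewrite col_mxEd uv//.
  by apply/andP; split => //; apply: ltW; near: s; exact: nbhs_right_lt.
- move=> i; case: (split_ordP i) => j ->.
    rewrite col_mxEu.
    apply: cvg_trans (cvg_comp _ _ xb (@coord_continuous R n 1 j ord0 (x b))).
    by apply: near_eq_cvg; apply: nearW => s; rewrite col_mxEu.
  rewrite col_mxEd (uv b) ?ab ?lexx//.
  apply: (@cvg_trans _ ((fun=> v j ord0) @ b^'-)); last exact: cvg_cst.
  apply: near_eq_cvg; near=> s; rewrite col_mxEd uv//.
  apply/andP; split; last by apply: ltW.
  by near: s; exact: nbhs_left_gt.
- move=> i s sab; have /andP[as_ sb] := sab; rewrite mulmx_Abar_col.
  case: (split_ordP i) => j ->.
    rewrite col_mxEu; under eq_fun do rewrite col_mxEu.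
    by apply: time_derivative_is_derive (dx s sab); exact: le_lt_trans a0 as_.
  rewrite col_mxEd mxE.
  apply: (near_eq_is_derive _ (is_derive_cst (v j ord0) s 1)).
  near=> r; rewrite col_mxEd uv//; apply/andP; split.
    by near: r; exact: lt_nbhsr.
  by apply: ltW; near: r; exact: lt_nbhsl.
Unshelve. all: by end_near. Qed.

(** The mode selected at [t k] is held up to and including [t k.+1], so it is read off there; this
    is why [sigma (t k.+1)] stands for the mode of jump [k]. *)
Lemma right_value_next (R : realType) (n m N : nat)
    (A : 'M[R]_n) (B : 'M[R]_(n, m)) (J : 'I_N -> 'M[R]_n)
    (K1 : 'I_N -> 'M[R]_(m, n)) (K2 : 'I_N -> 'M[R]_m)
    (P : 'I_N -> 'M[R]_(n + m)) (t : nat -> R)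
    (x : R -> 'cV[R]_n) (u : R -> 'cV[R]_m) (sigma : R -> 'I_N) (k : nat) :
  min_jumping_solution A B J K1 K2 P t x u sigma -> t k < t k.+1 ->
  right_value sigma (t k) (sigma (t k.+1)).
Proof.
move=> sol tk; near=> s; apply: (sol_mode sol); apply/andP; split => //.
by apply: ltW; near: s; exact: nbhs_right_lt.
Unshelve. all: by end_near. Qed.

Lemma solution_after_jump (R : realType) (n m N : nat)
    (A : 'M[R]_n) (B : 'M[R]_(n, m)) (J : 'I_N -> 'M[R]_n)
    (K1 : 'I_N -> 'M[R]_(m, n)) (K2 : 'I_N -> 'M[R]_m)
    (P : 'I_N -> 'M[R]_(n + m)) (t : nat -> R) (Tmin Tmax : R)
    (x : R -> 'cV[R]_n) (u : R -> 'cV[R]_m) (sigma : R -> 'I_N)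
    (k : nat) (s : R) (i := sigma (t k.+1)) :
  0 < Tmin -> dwell_range Tmin Tmax t ->
  min_jumping_solution A B J K1 K2 P t x u sigma -> t k < s <= t k.+1 ->
  col_mx (x s) (u s) = expmx ((s - t k) *: Abar A B)
    *m (Jbar (J i) (K1 i) (K2 i) *m col_mx (x (t k)) (u (t k))).
Proof.
move=> T0 tP sol /andP[ks sk].
have tle j l : (j <= l)%N -> t j <= t l.
  move=> jl; apply: le_trans (dwell_range_le (ltW T0) tP jl).
  by rewrite lerDl mulr_ge0// ltW.
have tk0 : 0 <= t k by apply: le_trans (tle _ _ (leq0n k)); case: tP.
have ti := right_value_next sol (lt_le_trans ks sk).
(* The upper block is the state after the jump, the lower one the input held until the next jump. *)
rewrite mul_block_col mul0mx addr0; apply: constant_input_flow => //.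
- move=> j; have := cvg_comp _ _ (sol_jump sol ti)
    (@coord_continuous R n 1 j ord0 (J i *m x (t k))).
  exact.
- by apply: (sol_left_continuous sol); exact: le_lt_trans tk0 ks.
- move=> r /andP[kr rs]; apply: (sol_flow sol); first by rewrite ltW ?(le_lt_trans tk0).
  move=> l; have [/tle lk|/tle kl] := leqP l k.
    by rewrite gt_eqF// (le_lt_trans lk).
  by rewrite lt_eqF// (lt_le_trans rs)// (le_trans sk).
- move=> r /andP[kr rs]; apply: (sol_input sol ti).
  by rewrite kr (le_trans rs).
Qed.

(** Here [0 < t 0], so 0 is not a jump time and the flow equation at 0 makes [x] right continuous
    there. *)
Lemma solution_before_jumps (R : realType) (n m N : nat)
    (A : 'M[R]_n) (B : 'M[R]_(n, m)) (J : 'I_N -> 'M[R]_n)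
    (K1 : 'I_N -> 'M[R]_(m, n)) (K2 : 'I_N -> 'M[R]_m)
    (P : 'I_N -> 'M[R]_(n + m)) (t : nat -> R) (Tmin Tmax : R)
    (x : R -> 'cV[R]_n) (u : R -> 'cV[R]_m) (sigma : R -> 'I_N) (s : R) :
  0 < Tmin -> dwell_range Tmin Tmax t ->
  min_jumping_solution A B J K1 K2 P t x u sigma -> 0 < s <= t 0%N ->
  col_mx (x s) (u s) = expmx (s *: Abar A B) *m col_mx (x 0) (u 0).
Proof.
move=> T0 tP sol /andP[s0 st].
have tne r : 0 <= r < s -> forall l, r != t l.
  move=> /andP[r0 rs] l; rewrite lt_eqF// (lt_le_trans rs)// (le_trans st)//.
  apply: le_trans (dwell_range_le (ltW T0) tP (leq0n l)).
  by rewrite lerDl mulr_ge0// ltW.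
rewrite -[X in expmx (X *: _)]subr0; apply: constant_input_flow => //.
- move=> i; apply: time_derivative_at_right0 (sol_flow sol (lexx 0) _).
  by apply: tne; rewrite lexx.
- exact: (sol_left_continuous sol).
- move=> r /andP[r0 rs]; apply: (sol_flow sol); first exact: ltW.
  by apply: tne; rewrite rs ltW.
- move=> r /andP[r0 rs]; apply: (sol_input_initial sol).
  by rewrite ltW// (le_trans rs).
Qed.

Lemma mx_norm_expmx_mulmx (R : realType) (q : nat) (M : 'M[R]_q) (a T : R)
    (z : 'cV[R]_q) : 0 <= a <= T ->
  `|expmx (a *: M) *m z| <= q%:R * expR (q%:R * (T * `|M|)) * `|z|.
Proof.
move=> /andP[a0 aT]; rewrite (le_trans (mx_norm_mulmx _ _))// -mulrA.
rewrite ler_wpM2l// ler_wpM2r// (le_trans (mx_norm_expmx _))// ler_expR.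
by rewrite ler_wpM2l// normrZ ger0_norm// ler_wpM2r.
Qed.

Theorem proposition2 (R : realType) (n m N : nat)
    (hn : (0 < n)%N) (hm : (0 < m)%N) (hN : (0 < N)%N)
    (A : 'M[R]_n) (B : 'M[R]_(n, m)) (J : 'I_N -> 'M[R]_n)
    (K1 : 'I_N -> 'M[R]_(m, n)) (K2 : 'I_N -> 'M[R]_m)
    (Tmin Tmax : R) (hTmin : 0 < Tmin) (hT : Tmin <= Tmax)
    (P : 'I_N -> 'M[R]_(n + m)) (hP : forall i : 'I_N, posdef (P i))
    (Pi : 'M[R]_N) (hPi0 : forall i j : 'I_N, 0 <= Pi i j)
    (hPi1 : (const_mx 1 : 'rV[R]_N) *m Pi = const_mx 1)
    (eps : R) (heps : 0 < eps)
    (hLMI : forall (i : 'I_N) (theta : R), Tmin <= theta <= Tmax ->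
      negsemidef
        ((Jbar (J i) (K1 i) (K2 i))^T *m expmx (theta *: (Abar A B)^T)
           *m (\sum_(j < N) Pi j i *: P j)
           *m expmx (theta *: Abar A B) *m Jbar (J i) (K1 i) (K2 i)
         - P i + eps%:M)) :
  forall t : nat -> R, dwell_range Tmin Tmax t ->
  asymptotically_stable (min_jumping_trajectories A B J K1 K2 P t).
Proof.
move=> t tP.
set Ab := Abar A B in hLMI.
pose Jb i := Jbar (J i) (K1 i) (K2 i).
have sumPi l : \sum_j Pi j l = 1.
  have /matrixP/(_ ord0 l) := hPi1; rewrite !mxE => <-.
  by apply: eq_bigr => j _; rewrite mxE mul1r.
have [D [rho [D0 rho01 decay]]] := min_jumping_decay heps hP.
have t00 : 0 <= t 0%N by case: tP.
(* Growth of the flow over a duration of at most [T]. *)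
pose E T := (n + m)%:R * expR ((n + m)%:R * (T * `|Ab|)).
have E0 T : 0 <= E T by rewrite mulr_ge0// expR_ge0.
pose Jmax := \sum_i `|Jb i|.
(* [c0] bounds the growth before the first jump, the summand 1 covering time 0 itself; [c1] bounds a
   jump followed by a flow of duration at most [Tmax]. *)
pose c0 := 1 + E (t 0%N).
pose c1 := E Tmax * ((n + m)%:R * Jmax).
have Jmax0 : 0 <= Jmax by rewrite sumr_ge0.
have c10 : 0 <= c1 by rewrite !mulr_ge0.
have c01 : 1 <= c0 by rewrite lerDl.
pose S := min_jumping_trajectories A B J K1 K2 P t.
have initial chi s : S chi -> 0 <= s <= t 0%N ->
    `|chi s| ^+ 2 <= c0 ^+ 2 * `|chi 0| ^+ 2.
  move=> [x [u [sigma [sol ->]]]] /andP[s0 st].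
  rewrite -exprMn lerXn2r ?nnegrE ?mulr_ge0 ?(le_trans ler01 c01)//.
  move: s0; rewrite le_eqVlt => /predU1P[<-|s0]; first by rewrite ler_peMl.
  rewrite (solution_before_jumps hTmin tP sol) ?s0//.
  rewrite (le_trans (@mx_norm_expmx_mulmx _ _ _ _ (t 0%N) _ _)) ?(ltW s0)//.
  by rewrite ler_wpM2r// lerDr.
have jumps chi k s : S chi -> t k < s <= t k.+1 ->
    `|chi s| ^+ 2 <= (c1 ^+ 2 * D * c0 ^+ 2) * rho ^+ k * `|chi 0| ^+ 2.
  move=> Schi ks; have chi0 := initial _ (t 0%N) Schi.
  rewrite t00 lexx in chi0; have {}chi0 := chi0 isT.
  have [x [u [sigma [sol chiE]]]] := Schi.
  have chi1 : `|chi s| <= c1 * `|chi (t k)|.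
    have sT : 0 <= s - t k <= Tmax.
      by have [_ /(_ k)] := tP; case/andP: ks; lra.
    rewrite chiE /= (solution_after_jump hTmin tP sol ks).
    rewrite (le_trans (mx_norm_expmx_mulmx _ _ sT))//.
    rewrite -/Ab -/(E Tmax) -[leRHS]mulrA ler_wpM2l//.
    rewrite (le_trans (mx_norm_mulmx _ _))// -mulrA ler_wpM2l// ler_wpM2r//.
    by rewrite /Jmax (bigD1 (sigma (t k.+1)))//= lerDl sumr_ge0.
  have chik : `|chi (t k)| ^+ 2 <= D * rho ^+ k * `|chi (t 0%N)| ^+ 2.
    (* Transition from one pre-jump state to the next: jump, then flow over the whole dwell time. *)
    pose X l := expmx ((t l.+1 - t l) *: Ab) *m Jb (sigma (t l.+1)).
    have tl l : t l < t l.+1 by have [_ /(_ l)] := tP; lra.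
    apply: (decay Pi X (fun l => chi (t l)) (fun l => sigma (t l.+1)) hPi0 sumPi).
    - move=> l; have [_ /(_ l)/(hLMI (sigma (t l.+1)))] := tP.
      by rewrite /X trmx_mul trmx_expmx linearZ/= !mulmxA.
    - move=> l; rewrite /X -mulmxA chiE.
      by rewrite (solution_after_jump hTmin tP sol (k := l)) ?tl ?lexx.
    - move=> l; rewrite chiE; apply: (sol_rule sol).
      exact: right_value_next sol (tl l).
  have rhok : 0 <= rho ^+ k by rewrite exprn_ge0//; case/andP: rho01.
  apply: (@le_trans _ _ (c1 ^+ 2 * `|chi (t k)| ^+ 2)).
    by rewrite -exprMn lerXn2r ?nnegrE// mulr_ge0.
  have -> : c1 ^+ 2 * D * c0 ^+ 2 * rho ^+ k * `|chi 0| ^+ 2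
      = c1 ^+ 2 * (D * rho ^+ k * (c0 ^+ 2 * `|chi 0| ^+ 2)) by ring.
  apply: ler_wpM2l; first exact: sqr_ge0.
  by apply: le_trans chik _; apply: ler_wpM2l => //; exact: mulr_ge0.
(* The sum dominates both the constant before the first jump and the one after it. *)
pose K := c0 ^+ 2 + c1 ^+ 2 * D * c0 ^+ 2.
have c1D0 : 0 <= c1 ^+ 2 * D * c0 ^+ 2.
  by apply: mulr_ge0 (sqr_ge0 _); exact: mulr_ge0 (sqr_ge0 _) D0.
apply: (asymptotically_stable_envelope hTmin tP (K := K) (rho := rho)) => //.
- by rewrite -[1]addr0 lerD// exprn_ege1.
- move=> chi s Schi st; rewrite (le_trans (initial _ _ Schi st))//.
  by rewrite ler_wpM2r ?sqr_ge0// lerDl.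
- move=> chi k s Schi ks; rewrite (le_trans (jumps _ _ _ Schi ks))//.
  rewrite ler_wpM2r ?sqr_ge0// ler_wpM2r ?lerDr ?sqr_ge0// exprn_ge0//.
  by case/andP: rho01.
Qed.
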